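(* Let $A\in M_n(\mathbb{C})$ be a P-matrix and let $\alpha\subseteq\langle n\rangle$. Then $\mathrm{ppt}(A,\alpha)$ is a P-matrix.
   Context: $M_n(\mathbb{C})$ is the set of $n\times n$ complex matrices and $\langle n\rangle=\{1,\ldots,n\}$. For $\alpha\subseteq\langle n\rangle$ let $\alpha^c=\langle n\rangle\setminus\alpha$. $A[\alpha,\beta]$ is the submatrix of $A$ with rows indexed by $\alpha$ and columns indexed by $\beta$ (indices in ascending order); $A[\alpha]=A[\alpha,\alpha]$, $A(\alpha,\alpha]=A[\alpha^c,\alpha]$, $A[\alpha,\alpha)=A[\alpha,\alpha^c]$, $A(\alpha)=A[\alpha^c,\alpha^c]$. An empty submatrix has determinant $1$ by convention. If $A[\alpha]$ is invertible, the Schur complement is $A/A[\alpha]=A(\alpha)-A(\alpha,\alpha]A[\alpha]^{-1}A[\alpha,\alpha)$, and the principal pivot transform $\mathrm{ppt}(A,\alpha)$ of $A$ relative to $\alpha$ is the $n\times n$ matrix obtained from $A$ by replacing, in place, $A[\alpha]$ by $A[\alpha]^{-1}$, $A[\alpha,\alpha)$ by $-A[\alpha]^{-1}A[\alpha,\alpha)$, $A(\alpha,\alpha]$ by $A(\alpha,\alpha]A[\alpha]^{-1}$, and $A(\alpha)$ by $A/A[\alpha]$; by convention $\mathrm{ppt}(A,\emptyset)=A$. A matrix in $M_n(\mathbb{C})$ is a P-matrix if all of its principal minors are positive (real) numbers; in particular $A[\alpha]$ is then invertible for every $\alpha$. *)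

(* Defs.v *)
From HB Require Import structures.
From mathcomp Require Import all_boot all_order all_algebra.
From mathcomp Require Import complex reals.

Set Implicit Arguments.
Unset Strict Implicit.
Unset Printing Implicit Defensive.

Import Order.TTheory GRing.Theory Num.Theory.
Local Open Scope ring_scope.

(* [enum_val : 'I_#|a| -> 'I_n] lists the elements of [a] in ascending order. *)
Definition submatrix (T : Type) (n : nat) (A : 'M[T]_n) (a b : {set 'I_n}) :
    'M[T]_(#|a|, #|b|) :=
  mxsub (@enum_val _ (mem a)) (@enum_val _ (mem b)) A.

(* The position of [i] within [a] or within its complement, whichever
   contains it. *)
Definition set_split (n : nat) (a : {set 'I_n}) (i : 'I_n) :
    'I_#|a| + 'I_#|~: a| :=
  match decP (@idP (i \in a)) with
  | left ia => inl (enum_rank_in ia i)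
  | right nia => inr (enum_rank_in (introT setCP nia) i)
  end.

(* The inverse of cutting a matrix into the four blocks [a, a], [a, ~: a],
   [~: a, a] and [~: a, ~: a]; see [submatrix_inplace]. *)
Definition inplace_mx (T : Type) (n : nat) (a : {set 'I_n})
    (ul : 'M[T]_(#|a|, #|a|)) (ur : 'M[T]_(#|a|, #|~: a|))
    (dl : 'M[T]_(#|~: a|, #|a|)) (dr : 'M[T]_(#|~: a|, #|~: a|)) : 'M[T]_n :=
  \matrix_(i, j)
    block_mx ul ur dl dr (unsplit (set_split a i)) (unsplit (set_split a j)).

(* Since [invmx B = B] when [B] is singular, [schur] and [ppt] are meaningful
   only when [submatrix A a a] is invertible. *)
Definition schur (F : fieldType) (n : nat) (A : 'M[F]_n) (a : {set 'I_n}) :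
    'M[F]_(#|~: a|) :=
  submatrix A (~: a) (~: a)
  - submatrix A (~: a) a *m invmx (submatrix A a a) *m submatrix A a (~: a).

Definition ppt (F : fieldType) (n : nat) (A : 'M[F]_n) (a : {set 'I_n}) :
    'M[F]_n :=
  inplace_mx
    (invmx (submatrix A a a))
    (- (invmx (submatrix A a a) *m submatrix A a (~: a)))
    (submatrix A (~: a) a *m invmx (submatrix A a a))
    (schur A a).

(* In [R[i]], [0 < z] means that [z] is real and positive.  The case
   [a = set0] is harmless: the determinant of a 0 x 0 matrix is 1. *)
Definition P_matrix (R : realType) (n : nat) (A : 'M[R[i]]_n) : Prop :=
  forall a : {set 'I_n}, 0 < \det (submatrix A a a).

Lemma set_split_val (n : nat) (a : {set 'I_n}) (k : 'I_#|a|) :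
  set_split a (enum_val k) = inl k.
Proof.
rewrite /set_split; case: decP => [ia | nia]; first by rewrite enum_valK_in.
by case: nia; apply: enum_valP.
Qed.

Lemma set_split_valC (n : nat) (a : {set 'I_n}) (k : 'I_#|~: a|) :
  set_split a (enum_val k) = inr k.
Proof.
rewrite /set_split; case: decP => [ia | nia]; last by rewrite enum_valK_in.
by have := enum_valP k; rewrite inE ia.
Qed.

Lemma submatrix_inplace (T : Type) (n : nat) (a : {set 'I_n})
    (ul : 'M[T]_(#|a|, #|a|)) (ur : 'M[T]_(#|a|, #|~: a|))
    (dl : 'M[T]_(#|~: a|, #|a|)) (dr : 'M[T]_(#|~: a|, #|~: a|)) :
  let B := inplace_mx ul ur dl dr in
  [/\ submatrix B a a = ul, submatrix B a (~: a) = ur,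
      submatrix B (~: a) a = dl & submatrix B (~: a) (~: a) = dr].
Proof.
by split; apply/matrixP => i j; rewrite [LHS]mxE [LHS]mxE
  ?set_split_val ?set_split_valC /=
  ?block_mxEul ?block_mxEur ?block_mxEdl ?block_mxEdr.
Qed.

Lemma ppt_set0 (F : fieldType) (n : nat) (A : 'M[F]_n) : ppt A set0 = A.
Proof.
have val0 (i : 'I_n) : exists k : 'I_#|~: (set0 : {set 'I_n})|, i = enum_val k.
  have ic : i \in ~: set0 by rewrite !inE.
  by exists (enum_rank_in ic i); rewrite enum_rankK_in.
apply/matrixP => i j; case: (val0 i) (val0 j) => k -> [l ->].
rewrite mxE !set_split_valC /= block_mxEdr !mxE big1 ?subr0 // => m _.
by have := ltn_ord m; rewrite [X in (_ < X)%N]cards0.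
Qed.

(* Main.v *)
Require Import Defs.
From mathcomp Require Import all_boot all_order all_algebra.
From mathcomp Require Import complex reals perm.

(** The principal minors of the transform [B := ppt A a] are ratios of principal
    minors of [A]: with [a <+> b] the symmetric difference of [a] and [b],
      [det B[b] * det A[a] = det A[a <+> b]]   ([det_submatrix_ppt]).
    If all principal minors of [A] are positive, so is every [det B[b]].

    For this identity, let [principal_rows A a] be the full-size matrix whose
    rows with index in [a] come from [A] and whose other rows come from the
    identity matrix.  Expanding along the identity rows shows that its
    determinant is [det A[a]] ([det_principal_rows]).  In the system
    [y = A x] the transform exchanges the roles of [x] and [y] on [a]: it sends
    the vector that agrees with [y] on [a] and with [x] off [a] to the vector
    that agrees with [x] on [a] and with [y] off [a].  In matrix form this is
      [B * principal_rows A a = principal_rows A (~: a)]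
    ([mul_ppt_principal_rows]).  Replacing the rows of [B] outside [b] by
    identity rows copies the corresponding rows of [principal_rows A a] into
    the product; each row of the product then comes from [A] if its index lies in
    exactly one of [a] and [b], and from the identity matrix otherwise. So
      [principal_rows B b * principal_rows A a = principal_rows A (a <+> b)],
    and it remains to take determinants. *)

Set Implicit Arguments.
Unset Strict Implicit.
Unset Printing Implicit Defensive.

Import Order.TTheory GRing.Theory Num.Theory.
Local Open Scope ring_scope.

Lemma mulmx_mxsub_bij (R : pzSemiRingType) (m n : nat) (f : 'I_n -> 'I_m)
    (M N : 'M[R]_m) :
  bijective f -> mxsub f f M *m mxsub f f N = mxsub f f (M *m N).
Proof.
move=> f_bij; apply/matrixP => i j; rewrite !mxE (reindex f) /=.
  by apply: eq_bigr => k _; rewrite !mxE.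
exact: onW_bij.
Qed.

Lemma det_mxsub_bij (R : comNzRingType) (m n : nat) (f : 'I_n -> 'I_m)
    (M : 'M[R]_m) :
  bijective f -> \det (mxsub f f M) = \det M.
Proof.
move=> f_bij; have := bij_eq_card f_bij; rewrite !card_ord => eq_nm.
(* Equal sizes turn the bijection into a permutation of the indices. *)
case: m / eq_nm in f M f_bij *.
pose s := perm (bij_inj f_bij).
have -> : mxsub f f M = row_perm s (col_perm s M).
  by apply/matrixP => i j; rewrite !mxE !permE.
rewrite row_permE col_permE !det_mulmx !det_perm odd_permV.
by rewrite mulrCA -signr_addb addbb mulr1.
Qed.

Definition block_index (n : nat) (a : {set 'I_n}) (i : 'I_n) :
    'I_(#|a| + #|~: a|) :=
  unsplit (set_split a i).

Lemma block_index_bij (n : nat) (a : {set 'I_n}) : bijective (block_index a).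
Proof.
pose g (k : 'I_(#|a| + #|~: a|)) : 'I_n :=
  match split k with inl i => enum_val i | inr i => enum_val i end.
exists g => [i | k]; rewrite /g /block_index.
  rewrite unsplitK /set_split; case: decP => [ia | nia].
    by rewrite enum_rankK_in.
  by rewrite enum_rankK_in // inE; apply/negP.
by rewrite -[RHS]splitK; case: (split k) => i;
  rewrite ?set_split_val ?set_split_valC.
Qed.

Lemma inplace_mxE (T : Type) (n : nat) (a : {set 'I_n})
    (ul : 'M[T]_(#|a|, #|a|)) (ur : 'M[T]_(#|a|, #|~: a|))
    (dl : 'M[T]_(#|~: a|, #|a|)) (dr : 'M[T]_(#|~: a|, #|~: a|)) :
  inplace_mx ul ur dl dr =
    mxsub (block_index a) (block_index a) (block_mx ul ur dl dr).
Proof. by []. Qed.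

Lemma inplace_submatrix (T : Type) (n : nat) (a : {set 'I_n}) (M : 'M[T]_n) :
  inplace_mx (submatrix M a a) (submatrix M a (~: a))
             (submatrix M (~: a) a) (submatrix M (~: a) (~: a)) = M.
Proof.
apply/matrixP => i j; rewrite mxE /set_split.
have inC k : ~ k \in a -> k \in ~: a by move=> nka; rewrite inE; apply/negP.
case: decP => [ia | nia]; case: decP => [ja | nja] /=;
  by rewrite ?block_mxEul ?block_mxEur ?block_mxEdl ?block_mxEdr
     mxE !enum_rankK_in //; apply: inC.
Qed.

Definition principal_rows (R : pzSemiRingType) (n : nat) (A : 'M[R]_n)
    (a : {set 'I_n}) : 'M[R]_n :=
  \matrix_(i, j) if i \in a then A i j else (1%:M : 'M[R]_n) i j.

Lemma row_principal_rows (R : pzSemiRingType) (n : nat) (A : 'M[R]_n)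
    (a : {set 'I_n}) (i : 'I_n) :
  row i (principal_rows A a) = if i \in a then row i A else row i 1%:M.
Proof. by apply/rowP => j; rewrite !mxE; case: ifP; rewrite !mxE. Qed.

Lemma enum_val_notin (n : nat) (a : {set 'I_n}) (k : 'I_#|~: a|) :
  (enum_val k \in a) = false.
Proof. by apply/negbTE; have := enum_valP k; rewrite inE. Qed.

Lemma enum_val_setC_neq (n : nat) (a : {set 'I_n}) (k : 'I_#|a|)
    (l : 'I_#|~: a|) : (enum_val k == enum_val l) = false.
Proof.
by apply/eqP => eq_kl; have := enum_valP k; rewrite eq_kl enum_val_notin.
Qed.

Lemma principal_rows_inplace (R : pzSemiRingType) (n : nat) (A : 'M[R]_n)
    (a : {set 'I_n}) :
  principal_rows A a =
    inplace_mx (submatrix A a a) (submatrix A a (~: a)) 0 1%:M.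
Proof.
rewrite -[LHS](inplace_submatrix a); congr inplace_mx;
  apply/matrixP => i j; rewrite !mxE ?enum_valP ?enum_val_notin //.
  by rewrite eq_sym enum_val_setC_neq.
by rewrite (inj_eq enum_val_inj).
Qed.

Lemma principal_rows_setC_inplace (R : pzSemiRingType) (n : nat) (A : 'M[R]_n)
    (a : {set 'I_n}) :
  principal_rows A (~: a) =
    inplace_mx 1%:M 0 (submatrix A (~: a) a) (submatrix A (~: a) (~: a)).
Proof.
rewrite -[LHS](inplace_submatrix a); congr inplace_mx;
  apply/matrixP => i j; rewrite !mxE inE ?enum_valP ?enum_val_notin //=.
  by rewrite (inj_eq enum_val_inj).
by rewrite enum_val_setC_neq.
Qed.

Lemma det_principal_rows (R : comNzRingType) (n : nat) (A : 'M[R]_n)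
    (a : {set 'I_n}) :
  \det (principal_rows A a) = \det (submatrix A a a).
Proof.
rewrite principal_rows_inplace inplace_mxE det_mxsub_bij.
  by rewrite det_ublock det1 mulr1.
exact: block_index_bij.
Qed.

(** The exchange property of the transform: applied to a column [x], both sides
    have the entries of [x] on [a] and those of [A *m x] off [a]. *)
Lemma mul_ppt_principal_rows (F : fieldType) (n : nat) (A : 'M[F]_n)
    (a : {set 'I_n}) :
  submatrix A a a \in unitmx ->
  ppt A a *m principal_rows A a = principal_rows A (~: a).
Proof.
move=> A_unit; rewrite principal_rows_inplace principal_rows_setC_inplace.
rewrite /ppt !inplace_mxE mulmx_mxsub_bij; last exact: block_index_bij.
rewrite mulmx_block !mulmx0 !mulmx1 !addr0 mulVmx // subrr.
by rewrite -mulmxA mulVmx // mulmx1 /schur addrC subrK.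
Qed.

(** Row [i] of the product is row [i] of [principal_rows A (~: a)] for [i] in [b],
    and row [i] of [principal_rows A a] for [i] outside [b]. *)
Lemma mul_principal_rows_ppt (F : fieldType) (n : nat) (A : 'M[F]_n)
    (a b : {set 'I_n}) :
  submatrix A a a \in unitmx ->
  principal_rows (ppt A a) b *m principal_rows A a =
    principal_rows A ((a :\: b) :|: (b :\: a)).
Proof.
move=> A_unit; apply/row_matrixP => i; rewrite row_mul !row_principal_rows.
case: ifP => ib; rewrite -row_mul ?mul_ppt_principal_rows // ?mul1mx.
  by rewrite row_principal_rows !inE ib; case: (i \in a).
by rewrite row_principal_rows !inE ib; case: (i \in a).
Qed.

Lemma det_submatrix_ppt (F : fieldType) (n : nat) (A : 'M[F]_n)
    (a b : {set 'I_n}) :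
  submatrix A a a \in unitmx ->
  let c := (a :\: b) :|: (b :\: a) in
  \det (submatrix (ppt A a) b b) * \det (submatrix A a a) =
    \det (submatrix A c c).
Proof.
move=> A_unit c.
by rewrite -!det_principal_rows -det_mulmx mul_principal_rows_ppt.
Qed.

Theorem theorem5p2 (R : realType) (n : nat) (A : 'M[R[i]]_n)
    (a : {set 'I_n}) (hA : P_matrix A) :
  P_matrix (ppt A a).
Proof.
move=> b; have A_unit : submatrix A a a \in unitmx.
  by rewrite unitmxE unitfE gt_eqF.
by rewrite -(pmulr_lgt0 _ (hA a)) det_submatrix_ppt.
Qed.
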